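(* Let $\mathcal{Q}$ be a bipartite quiver represented by nontrivial finite-dimensional real Hilbert spaces $H_1,\dots,H_n$ (sources) and $H^1,\dots,H^m$ (targets) and surjective linear maps $B_a : H_i \to H^j$ for each arrow $a \in \mathcal{A}_{ij}$, where $\mathcal{A}_{ij}$ is the finite set of arrows from $H_i$ to $H^j$, and let $\mathbf{p} = (p_1,\dots,p_m)$ with $p_j \in [1,\infty]$ for each $1 \le j \le m$. Let $\alpha_j := \sum_{i=1}^n \#(\mathcal{A}_{ij})$ be the number of arrows with target $H^j$. Let $\mathrm{BL}(\mathcal{Q},\mathbf{p}) \in [0,\infty]$ denote the smallest constant $C$ for which $$\prod_{i=1}^n \int_{H_i} \prod_{j=1}^m \prod_{a \in \mathcal{A}_{ij}} f_a(B_a x)\, dx \;\le\; C \prod_{i=1}^n \prod_{j=1}^m \prod_{a \in \mathcal{A}_{ij}} \|f_a\|_{L^{p_j}(H^j)}$$ holds for all families of measurable functions $f_a : H^j \to [0,\infty]$ (one function for each arrow $a \in \mathcal{A}_{ij}$, for all $i,j$), and let $\mathrm{BLCD}(\mathcal{Q},\mathbf{p}) \in [0,\infty]$ denote the smallest constant $C$ for which $$\prod_{i=1}^n \int_{H_i} \prod_{j=1}^m \prod_{a \in \mathcal{A}_{ij}} f_j(B_a x)\, dx \;\le\; C \prod_{i=1}^n \prod_{j=1}^m \prod_{a \in \mathcal{A}_{ij}} \|f_j\|_{L^{p_j}(H^j)} = C \prod_{j=1}^m \|f_j\|_{L^{p_j}(H^j)}^{\alpha_j}$$ holds for all measurable functions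 $f_j : H^j \to [0,\infty]$, $1 \le j \le m$ (one function for each target space). Then $$\mathrm{BLCD}(\mathcal{Q},\mathbf{p}) \;\le\; \mathrm{BL}(\mathcal{Q},\mathbf{p}) \;\le\; \left(\prod_{j=1}^m \alpha_j^{\alpha_j}\right) \mathrm{BLCD}(\mathcal{Q},\mathbf{p}).$$
   Context: A quiver is a directed multigraph, here with finitely many vertices and arrows. It is bipartite if its vertex set is a disjoint union of two sets such that every arrow has its source in the first set and its target in the second. A representation assigns a vector space to each vertex and a linear map to each arrow (from the space at its source to the space at its target). Here the quiver is identified with a representation of it: the source vertices carry $H_1,\dots,H_n$, the target vertices carry $H^1,\dots,H^m$, and each arrow $a$ carries a surjective linear map $B_a$. Distinct vertices may carry equal spaces and distinct arrows may carry equal maps (multisets). ''Nontrivial'' means nonzero. Each Hilbert space carries the Lebesgue measure induced by its inner product. $\#(\cdot)$ denotes cardinality. Conventions: $1/\infty = 0$ and $0\cdot\infty = 0$; empty products, and zeroth powers, equal $1$. The constants $C$ are allowed to be infinite. *)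

(* Defs.v *)
From HB Require Import structures.
From mathcomp Require Import all_boot all_order all_algebra.
From mathcomp Require Import all_classical all_reals all_analysis.
From mathcomp Require Import measurable_realfun.

Set Implicit Arguments.
Unset Strict Implicit.
Unset Printing Implicit Defensive.

Import Order.TTheory GRing.Theory Num.Theory.
Import numFieldNormedType.Exports.

Local Open Scope classical_set_scope.
Local Open Scope ring_scope.

(* A vectType is finite-dimensional, hence complete for any inner product. *)
Record hilbertSpace (R : realType) := HilbertSpace {
  space :> vectType R;
  inner : {dot space for idfun} }.

Section HilbertSpace.
Context {R : realType} (E : hilbertSpace R).
Implicit Types (u v w x y : E) (U : set E).

Definition hnorm v : R := Num.sqrt (inner E v v).

Definition hopen : set (set E) :=
  [set U | forall x, U x ->
     exists2 r : R, 0 < r & forall y, hnorm (y - x) < r -> U y].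

Definition orthonormal_basis (e : (\dim {: E}).-tuple E) : bool :=
  basis_of {: E} e && orthonormal (inner E) e.

Lemma innerC u v : inner E u v = inner E v u.
Proof. by rewrite (hermC (inner E)) expr0 mul1r. Qed.

Lemma inner_ge0 u : 0 <= inner E u u.
Proof.
have [->|u0] := eqVneq u 0; first by rewrite linear0l.
exact/ltW/neq0_dnorm_gt0.
Qed.

Lemma orthonormal_inner (s : seq E) : orthonormal (inner E) s -> uniq s ->
  {in s &, forall u v, inner E u v = (u == v)%:R}.
Proof.
move=> /andP[/allP s1 so] us u v us' vs.
have [<-|uv] := eqVneq u v; first exact/eqP/s1.
move: so uv us' vs; elim: {s1 us} s => // z t IH /= /andP[/andP[/allP zt _] tt].
move=> uv; rewrite !inE => /orP[/eqP uz|ut] /orP[/eqP vz|vt].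
- by move: uv; rewrite uz vz eqxx.
- by rewrite uz; apply/eqP/zt.
- by rewrite vz innerC; apply/eqP/zt.
- exact: IH.
Qed.

Lemma gram_schmidt k : (k <= \dim {: E})%N ->
  exists s : seq E, [/\ size s = k, free s & orthonormal (inner E) s].
Proof.
elim: k => [_|k IH kd]; first by exists [::]; rewrite /orthonormal /= nil_free.
have [s [ss fs os]] := IH (ltnW kd).
have [v vs] : exists v, v \notin span s.
  apply: contrapT => /forallNP H; move: kd.
  have : ({: E} <= span s)%VS by apply/subvP => v _; apply: contrapT => /negP /H.
  move=> /dimvS; have/eqP := fs; rewrite ss => ->.
  by rewrite leqNgt => /negbTE ->.
pose w := v - \sum_(e <- s) inner E v e *: e.
have ws : w \notin span s.
  apply: contra vs => ws; rewrite -[v](subrK (\sum_(e <- s) inner E v e *: e)).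
  rewrite memvD// big_seq memv_suml// => e es.
  by rewrite memvZ// memv_span.
have w0 : w != 0 by apply: contraNneq ws => ->; rewrite mem0v.
have wort e : e \in s -> inner E w e = 0.
  move=> es; rewrite innerC /w linearBr /= linear_sumr /= big_seq.
  have us : uniq s by exact: free_uniq.
  under eq_bigr do rewrite linearZr_LR /=.
  rewrite -big_seq (bigD1_seq e)//= (orthonormal_inner os us es es) eqxx mulr1.
  rewrite big_seq_cond big1 ?addr0 1?innerC ?subrr// => e' /andP[e's e'e].
  by rewrite (orthonormal_inner os us es e's) eq_sym (negbTE e'e) mulr0.
have nw : 0 < hnorm w by rewrite sqrtr_gt0 neq0_dnorm_gt0.
exists ((hnorm w)^-1 *: w :: s); split.
- by rewrite /= ss.
- rewrite free_cons fs andbT; apply: contra ws => /(memvZ (hnorm w)).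
  by rewrite scalerA divff ?gt_eqF// scale1r.
- case/andP: os => s1 so; rewrite /orthonormal /= s1 so !andbT; apply/andP; split.
    rewrite linearZl_LR linearZr_LR /= mulrA -invfM -expr2 sqr_sqrtr ?inner_ge0//.
    by rewrite mulVf// gt_eqF// neq0_dnorm_gt0.
  apply/allP => e es /=.
  by rewrite linearZl_LR /= wort// mulr0.
Qed.

Lemma ex_orthonormal_basis : exists e, orthonormal_basis e.
Proof.
have [s [ss fs os]] := gram_schmidt (leqnn _).
have sz : size s == \dim {: E} by rewrite ss.
exists (Tuple sz); rewrite /orthonormal_basis os andbT /=.
by rewrite basisEfree fs subvf ss leqnn.
Qed.

Definition onb : (\dim {: E}).-tuple E := xchoose ex_orthonormal_basis.

Lemma onbP : orthonormal_basis onb.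
Proof. exact: xchooseP. Qed.

Lemma inner_onb i j : inner E (tnth onb i) (tnth onb j) = (i == j)%:R.
Proof.
have /andP[/basis_free fo oo] := onbP.
have uo := free_uniq fo.
rewrite (orthonormal_inner oo uo) ?mem_tnth//; congr (nat_of_bool _)%:R.
by apply/eqP/eqP => [|->//]; exact/tuple_uniqP.
Qed.

End HilbertSpace.

Section LebesgueTuple.
Context {R : realType}.
Local Notation mR := (measurableTypeR R).

(* Lebesgue measure on R^n, as the n-fold product of lebesgue_measure, is the
   pushforward of the binary product of R and R^n.-1 along cons_pair. *)
Definition cons_pair n (z : mR * n.-tuple mR) : n.+1.-tuple mR :=
  [tuple of z.1 :: z.2].

Lemma measurable_cons_pair n : measurable_fun setT (@cons_pair n).
Proof. exact: measurable_cons. Qed.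

HB.instance Definition _ n := isMeasurableFun.Build _ _ _ _ (@cons_pair n)
  (@measurable_cons_pair n).

Section Cons.
Context (n : nat) (mu : {sigma_finite_measure set (n.-tuple mR) -> \bar R}).

Definition lebesgue_cons : set (n.+1.-tuple mR) -> \bar R :=
  pushforward (@lebesgue_measure R \x mu)%E (@cons_pair n).

Let lebesgue_cons0 : lebesgue_cons set0 = 0%E.
Proof. exact: measure0. Qed.

Let lebesgue_cons_ge0 A : (0 <= lebesgue_cons A)%E.
Proof. exact: measure_ge0. Qed.

Let lebesgue_cons_sigma_additive : semi_sigma_additive lebesgue_cons.
Proof. exact: measure_semi_sigma_additive. Qed.

HB.instance Definition _ := isMeasure.Build _ _ _ lebesgue_cons
  lebesgue_cons0 lebesgue_cons_ge0 lebesgue_cons_sigma_additive.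

Let sigma_finite_prod (nu : {sigma_finite_measure set mR -> \bar R}) :
  sigma_finite setT (nu \x mu)%E.
Proof.
have /sigma_finiteP[F [TF ndF Foo]] := sigma_finiteT nu.
have /sigma_finiteP[G [TG ndG Goo]] := sigma_finiteT mu.
exists (fun k => F k `*` G k).
  rewrite -setXTT TF TG predeqE => -[x y]; split.
    move=> [/= [k _ Fkx] [l _ Gly]]; exists (maxn k l) => //; split.
    - by move: x Fkx; exact/subsetPset/ndF/leq_maxl.
    - by move: y Gly; exact/subsetPset/ndG/leq_maxr.
  by move=> [k _ []/= ? ?]; split; exists k.
move=> k; have [? ?] := Foo k; have [? ?] := Goo k.
split; first exact: measurableX.
by rewrite product_measure1E// lte_mul_pinfty// ge0_fin_numE.
Qed.

Let lebesgue_cons_sigma_finite : sigma_finite setT lebesgue_cons.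
Proof.
have [F FT Foo] := sigma_finite_prod (@lebesgue_measure R).
pose uncons (t : n.+1.-tuple mR) : mR * n.-tuple mR :=
  (thead t, [tuple of behead t]).
have consK z : uncons (cons_pair z) = z.
  case: z => x t; rewrite /uncons /cons_pair; congr pair.
  exact/val_inj.
have muncons : measurable_fun setT uncons.
  apply: measurable_fun_pair; first exact: measurable_tnth.
  exact: measurable_behead.
exists (fun k => uncons @^-1` F k).
  by rewrite -preimage_bigcup -FT preimage_setT.
move=> k; have [mF Fk] := Foo k; split.
  by rewrite -[X in measurable X]setTI; exact: muncons.
rewrite /lebesgue_cons /pushforward (_ : _ @^-1` _ = F k)//.
by apply/seteqP; split => z /=; rewrite consK.
Qed.

HB.instance Definition _ := Measure_isSigmaFinite.Build _ _ _ lebesgue_cons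
  lebesgue_cons_sigma_finite.

End Cons.

Fixpoint lebesgue_tuple n : {sigma_finite_measure set (n.-tuple mR) -> \bar R} :=
  if n is k.+1 then lebesgue_cons (lebesgue_tuple k) else dirac [tuple].

End LebesgueTuple.

Section Borel.
Context {R : realType} (E : hilbertSpace R).
Local Notation mR := (measurableTypeR R).

(* E equipped with the Borel sigma-algebra of its norm topology. *)
Definition borel : Type := E.

HB.instance Definition _ := Choice.on borel.
HB.instance Definition _ := isPointed.Build borel (0 : E).
Let borelC (A : set borel) : <<s (@hopen R E) >> A -> <<s (@hopen R E) >> (~` A).
Proof. by move=> sA; rewrite -setTD; exact: sigma_algebraCD. Qed.

HB.instance Definition _ := @isMeasurable.Build (sigma_display (@hopen R E))
  borel <<s (@hopen R E) >> (@sigma_algebra0 _ setT (@hopen R E)) borelC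
  (@sigma_algebra_bigcup _ setT (@hopen R E)).

Definition of_coords (t : (\dim {: E}).-tuple mR) : borel :=
  \sum_i tnth t i *: tnth (onb E) i.

Lemma hnorm_of_coordsB (t u : (\dim {: E}).-tuple mR) :
  hnorm ((of_coords t : E) - of_coords u) =
  Num.sqrt (\sum_i (tnth t i - tnth u i) ^+ 2).
Proof.
rewrite /hnorm /of_coords -sumrB; congr Num.sqrt.
under eq_bigr do rewrite -scalerBl.
rewrite linear_sumlz; apply: eq_bigr => i _ /=.
rewrite linear_sumr (bigD1 i)//= big1 ?addr0 => [|j ji].
  by rewrite linearZl_LR linearZr_LR /= inner_onb eqxx mulr1 expr2.
by rewrite linearZl_LR linearZr_LR /= inner_onb eq_sym (negbTE ji) !mulr0.
Qed.

Lemma measurable_of_coords : measurable_fun setT of_coords.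
Proof.
apply: (@measurability _ _ _ borel _ _ (@hopen R E)) => // _ [U oU <-].
rewrite setTI.
set d := \dim {: E}.
pose box (z : d.-tuple rat * nat) : set (d.-tuple mR) :=
  [set t | forall i, `|tnth t i - ratr (tnth z.1 i)| < z.2.+1%:R^-1].
have mbox z : measurable (box z).
  rewrite (_ : box z = \bigcap_(i : 'I_d)
    ((fun t => tnth t i) @^-1` `]ratr (tnth z.1 i) - z.2.+1%:R^-1,
                                 ratr (tnth z.1 i) + z.2.+1%:R^-1[)); last first.
    apply/seteqP; split => t /= H i.
      by move=> _; rewrite /= in_itv /= -ltr_distl; exact: H.
    by have := H i I; rewrite /= in_itv /= -ltr_distl.
  apply: fin_bigcap_measurable => [|i _]; first exact: finite_finset.
  rewrite -[X in measurable X]setTI.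
  exact: (@measurable_tnth _ mR d i measurableT _ (measurable_itv _)).
rewrite (_ : of_coords @^-1` U =
  \bigcup_z (if `[< box z `<=` of_coords @^-1` U >] then box z else set0)).
  apply: countable_bigcupT_measurable => [|z]; first exact: countableP.
  by case: ifPn.
apply/seteqP; split => [t /= Ut|t [z _]]; last first.
  by case: asboolP => // + tz; exact.
have [r r0 rU] := oU _ Ut.
pose e : R := r / d.+1%:R.
have e0 : 0 < e by rewrite divr_gt0.
pose k := Num.bound (2 / e).
have k2 : 2 * k.+1%:R^-1 < e.
  rewrite -ltr_pdivlMr ?invr_gt0// invrK -ltr_pdivrMl// mulrC.
  apply: lt_le_trans (_ : k%:R <= _); last by rewrite ler_nat.
  by apply: archi_boundP; rewrite divr_ge0// ltW.
have rt (i : 'I_d) :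
    exists q : rat, `|tnth t i - ratr q| < k.+1%:R^-1.
  have := @rat_in_itvoo R (tnth t i - k.+1%:R^-1) (tnth t i + k.+1%:R^-1).
  case; first by rewrite ltrD2l (lt_trans (y := 0)) ?oppr_lt0 ?invr_gt0.
  by move=> q; rewrite in_itv /= -ltr_distl distrC => ?; exists q.
have [c tc] := choice rt.
exists ([tuple c i | i < d], k) => //.
have tb : box ([tuple c i | i < d], k) t by move=> i /=; rewrite tnth_mktuple.
case: asboolP => // -[] u ub /=; apply: rU.
rewrite hnorm_of_coordsB -[ltRHS]gtr0_norm// -sqrtr_sqr ltr_sqrt ?exprn_gt0//.
have de2 : d%:R * e ^+ 2 < r ^+ 2.
  have re : r = e * d.+1%:R by rewrite /e divfK.
  rewrite [X in _ < X ^+ 2]re [in ltRHS]exprMn [ltLHS]mulrC.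
  rewrite ltr_pM2l ?exprn_gt0// -natrX ltr_nat.
  by rewrite (@leq_trans d.+1)// (@leq_pexp2l _ 1 2).
apply: le_lt_trans de2.
rewrite -[X in X%:R](card_ord d) mulr_natl -sumr_const; apply: ler_sum => i _.
rewrite -[leLHS]real_normK ?num_real// ler_pXn2r ?nnegrE ?(ltW e0)// ltW//.
have {tb}ti := tb i; have {ub}ui := ub i.
rewrite (le_lt_trans (ler_distD (ratr (tnth [tuple c i | i < d] i)) _ _))//.
rewrite (lt_trans _ k2)// mulr_natl mulr2n ltrD//.
by rewrite distrC.
Qed.

HB.instance Definition _ :=
  isMeasurableFun.Build _ _ _ _ of_coords measurable_of_coords.

(* The Lebesgue measure induced by the inner product: coordinates in an
   orthonormal basis identify E with R^d. An orthogonal change of basis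
   preserves the Lebesgue measure of R^d, so the choice of onb is immaterial. *)
Definition lebesgue_hilbert : set borel -> \bar R :=
  pushforward (lebesgue_tuple (\dim {: E})) of_coords.

Let lebesgue_hilbert0 : lebesgue_hilbert set0 = 0%E.
Proof. exact: measure0. Qed.

Let lebesgue_hilbert_ge0 A : (0 <= lebesgue_hilbert A)%E.
Proof. exact: measure_ge0. Qed.

Let lebesgue_hilbert_sigma_additive : semi_sigma_additive lebesgue_hilbert.
Proof. exact: measure_semi_sigma_additive. Qed.

HB.instance Definition _ := isMeasure.Build _ _ _ lebesgue_hilbert
  lebesgue_hilbert0 lebesgue_hilbert_ge0 lebesgue_hilbert_sigma_additive.

End Borel.

Arguments lebesgue_hilbert {R} E A.

Record bipartiteQuiver (R : realType) (n m : nat) := BipartiteQuiver {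
  source : 'I_n -> hilbertSpace R;
  target : 'I_m -> hilbertSpace R;
  arrow : 'I_n -> 'I_m -> finType;
  arrow_map : forall i j, arrow i j -> {linear source i -> target j} }.

Section BrascampLieb.
Context {R : realType} {n m : nat}.
Context (Q : bipartiteQuiver R n m) (p : 'I_m -> \bar R).
Local Open Scope ereal_scope.

Definition alpha (j : 'I_m) : nat := (\sum_(i < n) #|arrow Q i j|)%N.

Definition BL_inequality (C : \bar R)
    (f : forall i j, arrow Q i j -> borel (target Q j) -> \bar R) : Prop :=
  \prod_(i < n) \int[lebesgue_hilbert (source Q i)]_x
     (\prod_(j < m) \prod_(a : arrow Q i j) f i j a (arrow_map a x))
  <= C * \prod_(i < n) \prod_(j < m) \prod_(a : arrow Q i j)
           Lnorm (lebesgue_hilbert (target Q j)) (p j) (f i j a).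

(* In \bar R, 0 * +oo = 0. *)
Definition BL : \bar R := ereal_inf [set C : \bar R | 0 <= C /\
  forall f : forall i j, arrow Q i j -> borel (target Q j) -> \bar R,
    (forall i j a, measurable_fun setT (f i j a)) ->
    (forall i j a y, 0 <= f i j a y) ->
    BL_inequality C f].

Definition BLCD : \bar R := ereal_inf [set C : \bar R | 0 <= C /\
  forall f : forall j, borel (target Q j) -> \bar R,
    (forall j, measurable_fun setT (f j)) ->
    (forall j y, 0 <= f j y) ->
    BL_inequality C (fun i j _ => f j)].

Lemma BLCD_rhsE (f : forall j, borel (target Q j) -> \bar R) :
  \prod_(i < n) \prod_(j < m) \prod_(a : arrow Q i j)
     Lnorm (lebesgue_hilbert (target Q j)) (p j) (f j) =
  \prod_(j < m) Lnorm (lebesgue_hilbert (target Q j)) (p j) (f j) ^+ alpha j.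
Proof.
rewrite exchange_big; apply: eq_bigr => j _ /=.
rewrite /alpha; set x := Lnorm _ _ _.
have expeD k l : x ^+ (k + l) = x ^+ k * x ^+ l.
  by elim: k => [|k IH]; rewrite ?expe0 ?mul1e// addSn !expeS IH muleA.
rewrite (big_morph _ expeD (expe0 x)); apply: eq_bigr => i _.
rewrite big_const; elim: #|_| => [|k IH]; first by rewrite expe0.
by rewrite iterS IH expeS.
Qed.

End BrascampLieb.

(* Main.v *)
(* Normalize the functions [f_a] and test the BLCD inequality on the sums
   [f_j := \sum_(a into H^j) f_a / |f_a|]: then [f_a <= |f_a| f_j] pointwise,
   and [|f_j| <= alpha_j] by Minkowski's inequality, where [|f_j|] occurs with
   exponent [alpha_j]. If some [|f_a|] vanishes while other norms may be infinite,
   the test functions [f_j := w_j + \sum_(|f_a| = 0) +oo * f_a], with [w_j] a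
   positive function of finite norm, show that finiteness of the BLCD constant
   already forces the left-hand side to be zero. *)
Require Import Defs.
From mathcomp Require Import all_boot all_order all_algebra.
From mathcomp Require Import all_classical all_reals all_analysis.
From mathcomp Require Import measurable_realfun ess_sup_inf.

Set Implicit Arguments.
Unset Strict Implicit.
Unset Printing Implicit Defensive.

Import Order.TTheory GRing.Theory Num.Theory.
Import numFieldNormedType.Exports.

Local Open Scope classical_set_scope.
Local Open Scope ring_scope.

(** * Finite products in [\bar R] *)

Section ExtendedReals.
Context {R : realType}.
Local Open Scope ereal_scope.

Lemma lee_prod {I : Type} (s : seq I) (P : pred I) (F G : I -> \bar R) :
  (forall i, P i -> 0 <= F i) -> (forall i, P i -> F i <= G i) ->
  \prod_(i <- s | P i) F i <= \prod_(i <- s | P i) G i.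
Proof.
(* Nonnegativity is carried through the induction, since products are monotone only on nonnegative
   factors. *)
move=> F0 FG; suff /andP[] : (0 <= \prod_(i <- s | P i) F i) &&
  (\prod_(i <- s | P i) F i <= \prod_(i <- s | P i) G i) by [].
elim/big_ind2: _ => [|x1 x2 y1 y2 /andP[? ?] /andP[? ?]|i Pi].
- by rewrite lee01 lexx.
- by rewrite mule_ge0// lee_pmul.
- by rewrite F0// FG.
Qed.

Lemma prode_gt0 {I : Type} (s : seq I) (P : pred I) (F : I -> \bar R) :
  (forall i, P i -> 0 < F i) -> 0 < \prod_(i <- s | P i) F i.
Proof. by move=> F0; elim/big_ind: _ => // x y; exact: mule_gt0. Qed.

Lemma prode_eq0 {I : finType} (F : I -> \bar R) :
  (\prod_(i : I) F i == 0) = [exists i, F i == 0].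
Proof.
apply/idP/idP => [|/existsP[i /eqP Fi]]; last by rewrite (bigD1 i)//= Fi mul0e.
apply: contraLR => /existsPn F0; elim/big_ind: _ => // x y x0 y0.
by rewrite mule_eq0 negb_or x0.
Qed.

Lemma prode_lty {I : Type} (s : seq I) (F : I -> \bar R) :
  (forall i, 0 <= F i) -> (forall i, F i < +oo) -> \prod_(i <- s) F i < +oo.
Proof.
move=> F0 Foo.
have : \prod_(i <- s) F i \is a fin_num.
  by apply: prode_fin_num => i _; rewrite ge0_fin_numE.
by rewrite ge0_fin_numE// prode_ge0.
Qed.

(* Positivity of the factors is needed because [0 * +oo = 0]. *)
Lemma prode_lty_factor {I : finType} (F : I -> \bar R) (i0 : I) :
  (forall i, 0 < F i) -> \prod_(i : I) F i < +oo -> F i0 < +oo.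
Proof.
move=> F0; rewrite (bigD1 i0)//= ltey; apply: contraTT.
by rewrite -leNgt leye_eq => /eqP ->; rewrite gt0_mulye ?eqxx// prode_gt0.
Qed.

Lemma emeasurable_prod d (T : measurableType d) (D : set T) {I : Type}
    (s : seq I) (f : I -> T -> \bar R) :
  (forall i, measurable_fun D (f i)) ->
  measurable_fun D (fun x => \prod_(i <- s) f i x).
Proof.
move=> mf; elim: s => [|i s IH].
  by under eq_fun do rewrite big_nil; exact: measurable_cst.
by under eq_fun do rewrite big_cons; exact: emeasurable_funM.
Qed.

End ExtendedReals.

(** * Norms of extended-real-valued functions *)

Section Lnorm.
Context d {T : measurableType d} {R : realType}.
Variable mu : {measure set T -> \bar R}.
Local Open Scope ereal_scope.
Implicit Types (p : \bar R) (f g : T -> \bar R).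

(** This allows replacing functions of finite norm by their real parts in [Lnorm_leD], and [+oo * f]
    by zero in [Lnorm_infty_mul]. *)
Lemma ae_eq_Lnorm p f g : measurable_fun setT f -> measurable_fun setT g ->
  f = g %[ae mu] -> Lnorm mu p f = Lnorm mu p g.
Proof.
move=> mf mg fg; rewrite unlock /Lnorm; case: p => [r| |].
- congr (_ `^ _); apply: ae_eq_integral => //.
  + exact/(measurableT_comp (measurable_poweR _))/measurableT_comp.
  + exact/(measurableT_comp (measurable_poweR _))/measurableT_comp.
  + by apply: filterS fg => x /= + xT => ->.
- case: ifPn => // _; apply: eq_ess_sup.
  by apply: filterS fg => x /= ->.
- case: ifPn => // _; apply: eq_ess_inf.
  by apply: filterS fg => x /= ->.
Qed.

Lemma Lnorm_pZl p f (c : R) : 1 <= p ->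
  (0 <= c)%R -> measurable_fun setT f ->
  Lnorm mu p (fun x => c%:E * f x) = c%:E * Lnorm mu p f.
Proof.
move=> p1 c0 mf; rewrite unlock /Lnorm; case: p p1 => [r r1|_|//].
- have r0 : (0 < r)%R by rewrite (lt_le_trans ltr01).
  under eq_integral do rewrite abseM gee0_abs ?lee_fin// poweRM ?lee_fin//.
  rewrite ge0_integralZl//; last 3 first.
  + exact/(measurableT_comp (measurable_poweR _))/measurableT_comp.
  + by move=> x _; exact: poweR_ge0.
  + exact: poweR_ge0.
  rewrite poweRM ?poweR_ge0//; last first.
    by apply: integral_ge0 => x _; exact: poweR_ge0.
  by rewrite -poweRrM mulfV ?gt_eqF// poweRe1.
(* At exponent [+oo], the norm is an essential supremum only on a space of positive measure, and
   zero by definition otherwise. *)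
- case: ifPn => [mu0|_]; last by rewrite mule0.
  rewrite -(ess_supZl (abse \o f) mu0 c0); congr ess_sup; apply/funext => x /=.
  by rewrite abseM gee0_abs ?lee_fin.
Qed.

Lemma Lnorm_ae_fin_num (r : R) f : (0 < r)%R -> measurable_fun setT f ->
  Lnorm mu r%:E f < +oo -> \forall x \ae mu, f x \is a fin_num.
Proof.
move=> r0 mf; rewrite unlock /Lnorm => /lty_poweRy; rewrite invr_neq0 ?gt_eqF//.
move=> /(_ isT) foo.
have : mu.-integrable setT (fun x => `|f x| `^ r).
  apply/integrableP; split.
    exact/(measurableT_comp (measurable_poweR _))/measurableT_comp.
  by under eq_integral do rewrite gee0_abs ?poweR_ge0//.
move=> /(integrable_ae measurableT); apply: filterS => x /(_ I).
rewrite ge0_fin_numE ?poweR_ge0// => /lty_poweRy.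
by rewrite gt_eqF// => /(_ isT); rewrite fin_num_abs.
Qed.

(** An infinite norm makes the bound trivial. Otherwise, at a finite exponent, both functions are
    finite almost everywhere and the real-valued Minkowski inequality applies to [fine \o f] and
    [fine \o g]; at exponent [+oo] the essential supremum is subadditive. *)
Lemma Lnorm_leD p f g : 1 <= p -> measurable_fun setT f ->
  measurable_fun setT g ->
  (forall x, 0 <= f x) -> (forall x, 0 <= g x) ->
  Lnorm mu p (f \+ g) <= Lnorm mu p f + Lnorm mu p g.
Proof.
move=> p1 mf mg f0 g0.
have [->|foo] := eqVneq (Lnorm mu p f) +oo.
  by rewrite addye ?leey// gt_eqF// (lt_le_trans _ (Lnorm_ge0 _ _ _)).
have [->|goo] := eqVneq (Lnorm mu p g) +oo.
  by rewrite addey ?leey// gt_eqF// (lt_le_trans _ (Lnorm_ge0 _ _ _)).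
case: p p1 foo goo => [r r1 foo goo|_ _ _|//]; last first.
  rewrite unlock /Lnorm; case: ifPn => mu0; last by rewrite adde0.
  apply: le_trans (ess_supD _ _ _); apply: le_ess_sup; apply: nearW => x /=.
  exact: lee_abs_add.
have r0 : (0 < r)%R by rewrite (lt_le_trans ltr01).
have fineE (h : T -> \bar R) : measurable_fun setT h ->
    Lnorm mu r%:E h != +oo -> h = EFin \o (fine \o h) %[ae mu].
  move=> mh hoo; have /= := Lnorm_ae_fin_num r0 mh _; rewrite ltey => /(_ hoo).
  by apply: filterS => x hx _ /=; rewrite fineK.
have mfine (h : T -> \bar R) :
    measurable_fun setT h -> measurable_fun setT (fine \o h).
  by move=> mh; exact: measurableT_comp.
have mEfine (h : T -> \bar R) :
    measurable_fun setT h -> measurable_fun setT (EFin \o (fine \o h)).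
  by move=> mh; exact/measurable_EFinP/mfine.
rewrite (ae_eq_Lnorm _ mf (mEfine _ mf) (fineE _ mf foo)).
rewrite (ae_eq_Lnorm _ mg (mEfine _ mg) (fineE _ mg goo)).
rewrite (@ae_eq_Lnorm _ _ (EFin \o ((fine \o f) \+ (fine \o g))%R)).
- by apply: minkowski_EFin => //; exact: mfine.
- exact: emeasurable_funD.
- by apply/measurable_EFinP; apply: measurable_funD; exact: mfine.
- apply: filterS2 (fineE _ mf foo) (fineE _ mg goo) => x /= fx gx _.
  by rewrite EFinD -fx// -gx.
Qed.

Lemma Lnorm_le_sum p {I : Type} (s : seq I) (f : I -> T -> \bar R) : 1 <= p ->
  (forall i, measurable_fun setT (f i)) -> (forall i x, 0 <= f i x) ->
  Lnorm mu p (fun x => \sum_(i <- s) f i x) <= \sum_(i <- s) Lnorm mu p (f i).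
Proof.
move=> p1 mf f0; elim: s => [|i s IH].
  rewrite big_nil (eq_Lnorm _ _ (g := cst 0)) ?Lnorm0//.
    by rewrite gt_eqF// (lt_le_trans _ p1).
  by move=> x; rewrite big_nil.
rewrite big_cons (eq_Lnorm _ _ (g := f i \+ fun x => \sum_(j <- s) f j x)).
  apply: le_trans (Lnorm_leD _ _ _ _ _) _ => //; last by rewrite leeD2l.
  - exact: emeasurable_sum.
  - by move=> x; exact: sume_ge0.
by move=> x; rewrite big_cons.
Qed.

(** A function of norm zero vanishes almost everywhere, and [+oo * 0 = 0]. *)
Lemma Lnorm_infty_mul p f : 1 <= p -> measurable_fun setT f ->
  Lnorm mu p f = 0 -> Lnorm mu p (fun x => +oo * f x) = 0.
Proof.
move=> p1 mf f0.
have p0 : 0 < p by rewrite (lt_le_trans _ p1).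
rewrite -(Lnorm0 mu (p := p)) ?gt_eqF//; apply: ae_eq_Lnorm => //.
  exact: measurable_funeM.
have := Lnorm_eq0_eq0 mf p0 f0.
by apply: filterS => x /= fx /fx ->; rewrite mule0.
Qed.

(** A weighted sum of indicators of a cover by sets of finite measure works: small weights give
    [w <= 1] and integral at most 1, which covers all exponents. *)
Lemma ex_pos_Lnorm_lty p : 1 <= p -> sigma_finite setT mu ->
  exists w : T -> \bar R, [/\ measurable_fun setT w, forall x, 0 < w x &
    Lnorm mu p w < +oo].
Proof.
move=> p1 [F TF Foo].
have mF k : measurable (F k) by case: (Foo k).
(* The dyadic factor makes the weights sum to at most 1. The divisor does the same for
   [c k * mu (F k)]; its summand 1 keeps it positive and [c k] below the dyadic factor. *)
pose c k : R := (1 / (2 ^ k.+1)%:R / (1 + fine (mu (F k))))%R.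
have muF0 k : (1 <= 1 + fine (mu (F k)))%R by rewrite lerDl fine_ge0.
have muF_gt0 k : (0 < 1 + fine (mu (F k)))%R by rewrite (lt_le_trans ltr01).
have c0 k : (0 < c k)%R.
  by rewrite /c !divr_gt0// ltr0n expn_gt0.
have c1 k : (c k <= 1 / (2 ^ k.+1)%:R)%R.
  by rewrite /c ler_pdivrMr// ler_peMr// divr_ge0.
have cmu k : (c k)%:E * mu (F k) <= (1 / (2 ^ k.+1)%:R)%:E.
  have [_ Fk] := Foo k.
  rewrite -[mu (F k)]fineK ?ge0_fin_numE// -EFinM lee_fin /c.
  by rewrite mulrAC ler_pdivrMr// ler_wpM2l ?divr_ge0// lerDr.
pose u k x : \bar R := (c k)%:E * (\1_(F k) x)%:E.
have u0 k x : 0 <= u k x by rewrite mule_ge0// lee_fin// ltW.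
have mu_ k : measurable_fun setT (u k).
  exact/measurable_funeM/measurable_EFinP/measurable_indic.
pose w (x : T) : \bar R := \sum_(k <oo) u k x.
have mw : measurable_fun setT w by apply: ge0_emeasurable_sum.
have w0 x : 0 <= w x by apply: nneseries_ge0.
have sum1 : \sum_(i <oo) (1 / (2 ^ i.+1)%:R)%:E <= 1%:E :> \bar R.
  exact: epsilon_trick0.
have w1 x : w x <= 1.
  apply: le_trans sum1.
  apply: lee_nneseries => k _ //.
  apply: (@le_trans _ _ (c k)%:E); last exact: c1.
  by rewrite /u -EFinM lee_fin ler_piMr ?(ltW (c0 k))// indicE; case: (_ \in _).
have iw : \int[mu]_x w x <= 1.
  rewrite integral_nneseries//.
  apply: le_trans sum1.
  apply: lee_nneseries => [k _ _|k _]; first exact: integral_ge0.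
  rewrite /u ge0_integralZl_EFin//; last by rewrite ltW.
    by rewrite integral_indic// setIT.
  exact/measurable_EFinP/measurable_indic.
exists w; split => //.
- move=> x; have [k _ Fkx] : (\bigcup_k F k) x by rewrite -TF.
  (* The partial sum of [k.+1] terms is the first to contain the positive term [u k x]. *)
  apply: lt_le_trans (nneseries_lim_ge k.+1 _) => //.
  rewrite big_nat_recr//=; apply: lt_le_trans (leeDr _ _); last exact: sume_ge0.
  by rewrite /u indicE mem_set// mule1 lte_fin.
- rewrite unlock /Lnorm; case: p p1 => [r r1|_|//].
  (* Since [0 <= w <= 1] and [1 <= r], the power [w ^ r] is at most [w]. *)
  + apply/poweR_lty/(le_lt_trans _ (ltry 1)); apply: le_trans iw.
    apply: ge0_le_integral => //.
    * by move=> x _; exact: poweR_ge0.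
    * exact/(measurableT_comp (measurable_poweR _))/measurableT_comp.
    * move=> x _; rewrite gee0_abs//.
      have wfin : w x \is a fin_num.
        by rewrite ge0_fin_numE// (le_lt_trans (w1 x)) ?ltry.
      move: (w0 x) (w1 x); rewrite -(fineK wfin) poweR_EFin !lee_fin => w0' w1'.
      have [->|wn0] := eqVneq (fine (w x)) 0%R.
        by rewrite powR0// gt_eqF// (lt_le_trans ltr01).
      by rewrite ge1r_powR ?lt0r ?wn0 ?w0'.
  + case: ifPn => [mu0|//]; apply: le_lt_trans (ltry 1).
    by apply/ess_supP/nearW => x /=; rewrite gee0_abs.
Qed.

End Lnorm.

(** * Orthonormal coordinates and measurability of linear maps *)

Section Coordinates.
Context {R : realType} (E : hilbertSpace R).
Local Notation mR := (measurableTypeR R).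

Definition coords (x : borel E) : (\dim {: E}).-tuple mR :=
  [tuple inner E x (tnth (onb E) i) | i < \dim {: E}].

Lemma of_coordsK : cancel (@of_coords R E) coords.
Proof.
move=> t; apply: eq_from_tnth => i; rewrite tnth_mktuple /of_coords.
rewrite linear_sumlz (bigD1 i)//= big1 ?addr0 => [|j ji].
  by rewrite linearZl_LR /= inner_onb eqxx mulr1.
by rewrite linearZl_LR /= inner_onb (negbTE ji) mulr0.
Qed.

Lemma coordsK : cancel coords (@of_coords R E).
Proof.
move=> x; have /andP[be _] := onbP E.
have -> : x = of_coords [tuple coord (onb E) i x | i < _].
  rewrite [LHS](coord_basis be (memvf _)) /of_coords.
  by apply: eq_bigr => i _; rewrite tnth_mktuple (tnth_nth 0).
by rewrite of_coordsK.
Qed.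

Lemma ler_coords_hnorm i (x y : borel E) :
  `|tnth (coords x) i - tnth (coords y) i| <= hnorm ((x : E) - y).
Proof.
rewrite -{2}(coordsK x) -{2}(coordsK y) hnorm_of_coordsB -sqrtr_sqr.
apply: ler_wsqrtr; rewrite (bigD1 i)//= lerDl.
by apply: sumr_ge0 => j _; exact: sqr_ge0.
Qed.

(** Each coordinate is 1-Lipschitz, so it pulls the open rays that generate the Borel sets of the
    line back to sets in [hopen]. *)
Lemma measurable_coords : measurable_fun setT coords.
Proof.
apply/measurable_fun_tnthP => i.
apply: (measurability _ (RGenOInfty.measurableE R)) => //.
move=> _ [_ [a ->] <-]; rewrite setTI; apply: sub_sigma_algebra => x /=.
rewrite in_itv/= andbT => ax.
exists (tnth (coords x) i - a); first by rewrite subr_gt0.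
move=> y; rewrite in_itv/= andbT => /(le_lt_trans (ler_coords_hnorm i y x)).
rewrite distrC => /(le_lt_trans (ler_norm _)).
by rewrite ltrD2l ltrN2.
Qed.

(** A cover of the coordinate space by sets of finite measure is pulled back along [coords];
    measures are kept because [coords] inverts [of_coords]. *)
Lemma sigma_finite_lebesgue_hilbert : sigma_finite setT (lebesgue_hilbert E).
Proof.
have [F TF Foo] := sigma_finiteT (@lebesgue_tuple R (\dim {: E})).
exists (fun k => coords @^-1` F k).
  by rewrite -preimage_bigcup -TF preimage_setT.
move=> k; have [mF Fk] := Foo k; split.
  by rewrite -[X in measurable X]setTI; exact: measurable_coords.
rewrite /lebesgue_hilbert /pushforward (_ : _ @^-1` _ = F k)//.
by apply/seteqP; split => z /=; rewrite of_coordsK.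
Qed.

End Coordinates.

Arguments coords {R E} x.

(** In orthonormal coordinates [B] is the matrix [c], and each entry of a matrix-vector product is a
    finite sum of measurable functions. *)
Lemma measurable_linear (R : realType) (E F : hilbertSpace R)
    (B : {linear E -> F}) :
  measurable_fun setT (B : borel E -> borel F).
Proof.
pose c i j : R := inner F (B (tnth (onb E) j)) (tnth (onb F) i).
pose M (t : (\dim {: E}).-tuple (measurableTypeR R)) :
    (\dim {: F}).-tuple (measurableTypeR R) :=
  [tuple \sum_j tnth t j * c i j | i < _].
have -> : (B : borel E -> borel F) = @of_coords R F \o (M \o coords).
  apply/funext => x /=; rewrite -[LHS](@coordsK _ F (B x)); congr of_coords.
  apply: eq_from_tnth => i; rewrite !tnth_mktuple -[in LHS](@coordsK _ E x).
  rewrite /of_coords linear_sum linear_sumlz; apply: eq_bigr => j _.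
  by rewrite linearZ linearZl_LR.
apply: measurableT_comp; first exact: measurable_of_coords.
apply: measurableT_comp; last exact: measurable_coords.
apply/measurable_fun_tnthP => i.
rewrite (_ : _ \o _ = fun t => \sum_j tnth t j * c i j); last first.
  by apply/funext => t /=; rewrite tnth_mktuple.
apply: measurable_sum => j; apply: measurable_funM => //.
exact: measurable_tnth.
Qed.

(** * Left-hand sides, and sums over the arrows into a target *)

Section BrascampLiebLemmas.
Context {R : realType} {n m : nat}.
Context (Q : bipartiteQuiver R n m) (p : 'I_m -> \bar R).
Hypothesis p_ge1 : forall j, (1 <= p j)%E.
Local Open Scope ereal_scope.

Local Notation family :=
  (forall i j, arrow Q i j -> borel (target Q j) -> \bar R).
Local Notation norm j := (Lnorm (lebesgue_hilbert (target Q j)) (p j)).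

Definition BL_integrand (f : family) i (x : borel (source Q i)) : \bar R :=
  \prod_(j < m) \prod_(a : arrow Q i j) f i j a (arrow_map a x).

Definition BL_lhs (f : family) : \bar R :=
  \prod_(i < n) \int[lebesgue_hilbert (source Q i)]_x BL_integrand f x.

Lemma measurable_BL_integrand (f : family) i :
  (forall i j a, measurable_fun setT (f i j a)) ->
  measurable_fun setT (@BL_integrand f i).
Proof.
move=> mf; apply: emeasurable_prod => j; apply: emeasurable_prod => a.
exact: (measurableT_comp (mf i j a) (measurable_linear (arrow_map a))).
Qed.

Lemma BL_integrand_ge0 (f : family) i x :
  (forall i j a y, 0 <= f i j a y) -> 0 <= @BL_integrand f i x.
Proof. by move=> f0; apply: prode_ge0 => j _; exact: prode_ge0. Qed.

(** Pointwise domination multiplies over the arrows, and the constants leave each integral by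
    homogeneity. *)
Lemma BL_lhs_scale (f g : family) (c : forall i j, arrow Q i j -> \bar R) :
  (forall i j a, measurable_fun setT (f i j a)) ->
  (forall i j a y, 0 <= f i j a y) ->
  (forall i j a, measurable_fun setT (g i j a)) ->
  (forall i j a y, 0 <= g i j a y) ->
  (forall i j a, 0 <= c i j a) ->
  (forall i j a y, f i j a y <= c i j a * g i j a y) ->
  BL_lhs f <=
  \prod_(i < n) \prod_(j < m) \prod_(a : arrow Q i j) c i j a * BL_lhs g.
Proof.
move=> mf f0 mg g0 c0 fg; rewrite /BL_lhs -big_split /=; apply: lee_prod => i _.
  by apply: integral_ge0 => x _; exact: BL_integrand_ge0.
have c0' : 0 <= \prod_(j < m) \prod_(a : arrow Q i j) c i j a.
  by apply: prode_ge0 => j _; exact: prode_ge0.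
rewrite -ge0_integralZl//; last 2 first.
- exact: measurable_BL_integrand.
- by move=> x _; exact: BL_integrand_ge0.
apply: ge0_le_integral => //.
- by move=> x _; exact: BL_integrand_ge0.
- exact: measurable_BL_integrand.
- by apply: measurable_funeM; exact: measurable_BL_integrand.
move=> x _; rewrite /BL_integrand -big_split /=.
apply: lee_prod => j _; first by apply: prode_ge0.
by rewrite -big_split /=; apply: lee_prod.
Qed.

(** The result depends on the target only, so it is an admissible test function for [BLCD]. *)
Definition target_sum (f : family) j (y : borel (target Q j)) : \bar R :=
  \sum_(i < n) \sum_(a : arrow Q i j) f i j a y.

Lemma measurable_target_sum (f : family) j :
  (forall i j a, measurable_fun setT (f i j a)) ->
  measurable_fun setT (@target_sum f j).
Proof. by move=> mf; apply: emeasurable_sum => i; exact: emeasurable_sum. Qed.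

Lemma target_sum_ge0 (f : family) j y :
  (forall i j a y, 0 <= f i j a y) -> 0 <= @target_sum f j y.
Proof. by move=> f0; apply: sume_ge0 => i _; exact: sume_ge0. Qed.

Lemma le_target_sum (f : family) i j (a : arrow Q i j) y :
  (forall i j a y, 0 <= f i j a y) -> f i j a y <= target_sum f y.
Proof.
move=> f0; rewrite /target_sum (bigD1 i)//= (bigD1 a)//= -addeA leeDl//.
rewrite adde_ge0//; first exact: sume_ge0.
by apply: sume_ge0 => k _; exact: sume_ge0.
Qed.

Lemma Lnorm_target_sum (f : family) j :
  (forall i j a, measurable_fun setT (f i j a)) ->
  (forall i j a y, 0 <= f i j a y) ->
  norm j (@target_sum f j) <=
  \sum_(i < n) \sum_(a : arrow Q i j) norm j (f i j a).
Proof.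
move=> mf f0; apply: le_trans (Lnorm_le_sum _ _ _ _ _) _ => //.
- by move=> i; exact: emeasurable_sum.
- by move=> i y; exact: sume_ge0.
- by apply: lee_sum => i _; exact: Lnorm_le_sum.
Qed.

(** For each target [j], the factor [alpha Q j] occurs once per arrow into [j], that is [alpha Q j]
    times; splitting the exponent over the sources matches the two sides. *)
Lemma prod_alphaE :
  \prod_(i < n) \prod_(j < m) \prod_(a : arrow Q i j) (alpha Q j)%:R%:E =
  (\prod_(j < m) alpha Q j ^ alpha Q j)%N%:R%:E :> \bar R.
Proof.
rewrite exchange_big /= natr_prod -prodEFin; apply: eq_bigr => j _.
rewrite {3}/alpha expn_sum natr_prod -prodEFin; apply: eq_bigr => i _.
by rewrite prodEFin -natr_prod prod_nat_const.
Qed.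

(** * From a finite constant for [BLCD] to one for [BL] *)

Section FromBLCD.
Variable C : R.
Hypothesis C_ge0 : (0 <= C)%R.
Hypothesis BLCD_C : forall h : forall j, borel (target Q j) -> \bar R,
  (forall j, measurable_fun setT (h j)) -> (forall j y, 0 <= h j y) ->
  BL_inequality p C%:E (fun i j _ => h j).

Variable f : family.
Hypothesis mf : forall i j (a : arrow Q i j), measurable_fun setT (f a).
Hypothesis f0 : forall i j (a : arrow Q i j) y, 0 <= f a y.

(** The test function at [j] is the sum of all [f b / N b] over arrows [b] into [j]. It dominates
    each summand, so [f a] is at most [N a] times it. The weights stay free: norms are the main
    choice, and 1 serves when [C = 0]. *)
Lemma BL_lhs_le_target_sum (N : forall i j, arrow Q i j -> R) :
  (forall i j a, 0 < N i j a)%R ->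
  BL_lhs f <=
  \prod_(i < n) \prod_(j < m) \prod_(a : arrow Q i j) (N i j a)%:E *
  (C%:E * \prod_(i < n) \prod_(j < m) \prod_(a : arrow Q i j)
     \sum_(k < n) \sum_(b : arrow Q k j) (N k j b)^-1%:E * norm j (f b)).
Proof.
move=> N0.
pose g : family := fun i j a y => (N i j a)^-1%:E * f a y.
have mg i j a : measurable_fun setT (g i j a).
  by apply: measurable_funeM; exact: mf.
have g0 i j a y : 0 <= g i j a y.
  by apply: mule_ge0; [rewrite lee_fin invr_ge0 ltW|exact: f0].
have ht := Lnorm_target_sum _ mg g0.
have mh j : measurable_fun setT (@target_sum g j).
  exact: measurable_target_sum.
have h0 j y := @target_sum_ge0 g j y g0.
apply: le_trans (@BL_lhs_scale f (fun i j _ => @target_sum g j)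
  (fun i j a => (N i j a)%:E) _ _ _ _ _ _) _ => //.
- by move=> i j a; rewrite lee_fin ltW.
- move=> i j a y; rewrite muleC -lee_pdivrMr// muleC.
  exact: le_target_sum a y g0.
apply: lee_wpmul2l.
  by do 3 (apply: prode_ge0 => ? _); rewrite lee_fin ltW.
apply: le_trans (BLCD_C mh h0) _.
apply: lee_wpmul2l; first by rewrite lee_fin.
apply: lee_prod => i _.
  by do 2 (apply: prode_ge0 => ? _); exact: Lnorm_ge0.
apply: lee_prod => j _; first by apply: prode_ge0 => ? _; exact: Lnorm_ge0.
apply: lee_prod => a _; first exact: Lnorm_ge0.
apply: le_trans (ht j) _; apply: lee_sum => k _; apply: lee_sum => b _.
by rewrite Lnorm_pZl// invr_ge0 ltW.
Qed.

(* The norms of the other functions may be infinite, so the target-indexed test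
   functions only remember that [f i j a] vanishes almost everywhere: they are
   positive, have finite norms, and are infinite wherever [f i j a > 0]. *)
Lemma BL_lhs_eq0 i0 j0 (a0 : arrow Q i0 j0) :
  norm j0 (f a0) = 0 -> BL_lhs f = 0.
Proof.
move=> N0.
have wP j := cid (ex_pos_Lnorm_lty (p_ge1 j)
  (sigma_finite_lebesgue_hilbert (target Q j))).
pose w j := sval (wP j).
have mw j : measurable_fun setT (w j) by rewrite /w; case: (wP j) => ? [].
have w_gt0 j y : 0 < w j y by rewrite /w; case: (wP j) => ? [].
have w_lty j : norm j (w j) < +oo by rewrite /w; case: (wP j) => ? [].
(* The factor 0 erases the functions of nonzero norm, even where they are infinite; the factor [+oo]
   keeps norm zero. Hence every [g i j a] has norm zero. *)
pose c i j (a : arrow Q i j) : \bar R := if norm j (f a) == 0 then +oo else 0.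
pose g : family := fun i j a y => c i j a * f a y.
have mg i j a : measurable_fun setT (g i j a).
  by apply: measurable_funeM; exact: mf.
have g0 i j a y : 0 <= g i j a y.
  by apply: mule_ge0; [rewrite /c; case: ifP|exact: f0].
have Ng i j a : norm j (g i j a) = 0.
  rewrite /g /c; have [fa0|_] := eqVneq (norm j (f a)) 0.
    exact: Lnorm_infty_mul.
  by rewrite Lnorm_pZl// mul0e.
(* Adding [w j] makes the test function positive everywhere, so that finiteness of a product passes
   to its factors. *)
pose h j y := w j y + @target_sum g j y.
have mt j : measurable_fun setT (@target_sum g j).
  exact: measurable_target_sum.
have t0 j y := @target_sum_ge0 g j y g0.
have mh j : measurable_fun setT (h j) by exact: emeasurable_funD.
have h_gt0 j y : 0 < h j y by rewrite (lt_le_trans (w_gt0 j y))// leeDl.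
have h0 j y : 0 <= h j y by exact/ltW.
have h_lty j : norm j (h j) < +oo.
  apply: le_lt_trans (Lnorm_leD _ (p_ge1 j) (mw j) (mt j) _ (t0 j)) _.
    by move=> y; exact/ltW.
  apply: lte_add_pinfty => //; apply: le_lt_trans (Lnorm_target_sum j mg g0) _.
  by rewrite big1 ?ltry// => i _; rewrite big1.
pose H : family := fun i j _ => h j.
have mH i j a : measurable_fun setT (H i j a) by exact: mh.
have H0 i j a y : 0 <= H i j a y by exact: h0.
have int_gt0 i x : 0 < @BL_integrand H i x.
  by apply: prode_gt0 => j _; apply: prode_gt0 => a _; exact: h_gt0.
have H_lty : BL_lhs H < +oo.
  apply: le_lt_trans (BLCD_C mh h0) _; apply: lte_mul_pinfty => //.
  apply: prode_lty => i.
    by do 2 (apply: prode_ge0 => ? _); exact: Lnorm_ge0.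
  apply: prode_lty => j; first by apply: prode_ge0 => ? _; exact: Lnorm_ge0.
  by apply: prode_lty => // a; exact: Lnorm_ge0.
have int_eq0 i : (\forall x \ae lebesgue_hilbert (source Q i),
    BL_integrand f x = 0) -> BL_lhs f = 0.
  move=> fx0; apply/eqP; rewrite prode_eq0; apply/existsP; exists i; apply/eqP.
  rewrite (ge0_ae_eq_integral (g := cst 0))//.
  - exact: integral0.
  - exact: measurable_BL_integrand.
  - by move=> x _; exact: BL_integrand_ge0.
  - by apply: filterS fx0 => x ->.
(* A finite product could hide an infinite integral behind a zero one. But a zero integral of the
   positive integrand of [H] makes that source a null set, and then the integrand of [f] vanishes
   almost everywhere there. *)
have [/existsP[i /eqP Hi0]|/existsPn Hi] := boolP [exists i,
    \int[lebesgue_hilbert (source Q i)]_x @BL_integrand H i x == 0].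
  apply: (int_eq0 i).
  have : \int[lebesgue_hilbert (source Q i)]_x `|@BL_integrand H i x| = 0.
    by rewrite -[RHS]Hi0; apply: eq_integral => x _; rewrite gee0_abs// ltW.
  move=> /(ae_eq_integral_abs _ measurableT (measurable_BL_integrand mH)).
  by apply: filterS => x /(_ I) Hx; have := int_gt0 i x; rewrite Hx ltxx.
(* Now all integrals are positive, so the one at [i0] is finite and the integrand of [H] is finite
   almost everywhere. Its factor at [a0] is then finite too, which fails wherever [f a0] is
   positive. *)
apply: (int_eq0 i0).
have Hi0_lty :
    \int[lebesgue_hilbert (source Q i0)]_x @BL_integrand H i0 x < +oo.
  apply: prode_lty_factor H_lty => i; rewrite lt0e Hi integral_ge0// => x _.
  exact/ltW.
have : (lebesgue_hilbert (source Q i0)).-integrable setT (@BL_integrand H i0).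
  apply/integrableP; split; first exact: measurable_BL_integrand.
  by under eq_integral do rewrite gee0_abs ?ltW//.
move=> /(integrable_ae measurableT); apply: filterS => x /(_ I).
rewrite ge0_fin_numE; last exact/ltW.
have [fx0 _|fx0] := eqVneq (f a0 (arrow_map a0 x)) 0.
  by rewrite /BL_integrand (bigD1 j0)//= (bigD1 a0)//= fx0 !mul0e.
move=> /prode_lty_factor => /(_ j0); have Ha_gt0 j : 0 <
    \prod_(a : arrow Q i0 j) H i0 j a (arrow_map a x).
  by apply: prode_gt0 => a _; exact: h_gt0.
move=> /(_ Ha_gt0)/prode_lty_factor => /(_ a0 (fun a => h_gt0 _ _)).
rewrite /H /h ltNge; case/negP.
suff : g i0 j0 a0 (arrow_map a0 x) = +oo.
  move=> gx; rewrite -gx; apply: le_trans (le_target_sum _ _ g0) _.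
  by rewrite leeDr// ltW.
by rewrite /g /c N0 eqxx gt0_mulye// lt0e fx0 f0.
Qed.

(** Once the cases of zero constant, a zero norm and an infinite product of norms are settled, all
    norms are positive reals and can serve as the weights [N]. *)
Lemma BL_of_BLCD :
  BL_inequality p ((\prod_(j < m) alpha Q j ^ alpha Q j)%N%:R%:E * C%:E) f.
Proof.
rewrite /BL_inequality -/(BL_lhs f).
set K := _%:R%:E; set P := (X in _ * X).
have K0 : 0 <= K by rewrite lee_fin.
have P0 : 0 <= P by do 3 (apply: prode_ge0 => ? _); exact: Lnorm_ge0.
(* For [C = 0] both bounds are zero, by [0 * +oo = 0] even if norms are infinite, so any positive
   weights do. *)
have [Ceq0|Cneq0] := eqVneq C 0%R.
  rewrite Ceq0 mule0 mul0e.
  apply: le_trans (BL_lhs_le_target_sum (N := fun _ _ _ => 1%R) _) _ => //.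
  by rewrite Ceq0 mul0e mule0.
have C_gt0 : (0 < C)%R by rewrite lt0r Cneq0.
have [[i [j [a Na0]]]|N_neq0] := pselect (exists i j (a : arrow Q i j),
    norm j (f a) = 0).
  by rewrite (BL_lhs_eq0 Na0) !mule_ge0.
have N_gt0 i j (a : arrow Q i j) : 0 < norm j (f a).
  rewrite lt0e Lnorm_ge0 andbT; apply/eqP => Na0.
  by apply: N_neq0; exists i, j, a.
(* Here the bound is [+oo], as [K] and [C] are positive; a target without arrows contributes
   [0 ^ 0 = 1] to [K]. *)
have [Poo|] := eqVneq P +oo.
  rewrite Poo gt0_muley ?leey// mule_gt0// lte_fin ltr0n.
  by apply: prodn_gt0 => j; rewrite expn_gt0; case: (alpha Q j).
rewrite -ltey => Poo.
have N_lty i j (a : arrow Q i j) : norm j (f a) < +oo.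
  apply: (prode_lty_factor a (F := fun a => norm j (f a))); first exact: N_gt0.
  apply: (prode_lty_factor j
    (F := fun j => \prod_(a : arrow Q i j) norm j (f a))).
    by move=> j'; apply: prode_gt0.
  apply: prode_lty_factor Poo => i'.
  by apply: prode_gt0 => j' _; apply: prode_gt0.
pose N i j (a : arrow Q i j) := fine (norm j (f a)).
have NE i j (a : arrow Q i j) : (N i j a)%:E = norm j (f a).
  by rewrite /N fineK// ge0_fin_numE ?Lnorm_ge0.
have N0 i j (a : arrow Q i j) : (0 < N i j a)%R by rewrite -lte_fin NE.
apply: le_trans (BL_lhs_le_target_sum N0) _.
have -> : \prod_(i < n) \prod_(j < m) \prod_(a : arrow Q i j) (N i j a)%:E = P.
  by do 3 (apply: eq_bigr => ? _).
rewrite muleC [K * _]muleC; apply: lee_wpmul2r => //.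
apply: lee_wpmul2l; first by rewrite lee_fin.
rewrite /K -prod_alphaE le_eqVlt; apply/orP; left; apply/eqP.
(* Every summand is now [N^-1 * N = 1], so the inner sum counts the arrows into the target. *)
do 3 (apply: eq_bigr => ? _); rewrite /alpha natr_sum -sumEFin.
apply: eq_bigr => k _; rewrite -sum1_card natr_sum -sumEFin.
by apply: eq_bigr => b _; rewrite -NE -EFinM mulVf// gt_eqF.
Qed.

End FromBLCD.

End BrascampLiebLemmas.

Theorem theorem1p11 (R : realType) (n m : nat) (Q : bipartiteQuiver R n m)
    (p : 'I_m -> \bar R)
    (source_neq0 : forall i : 'I_n, fullv != 0%VS :> {vspace source Q i})
    (target_neq0 : forall j : 'I_m, fullv != 0%VS :> {vspace target Q j})
    (arrow_surj : forall (i : 'I_n) (j : 'I_m) (a : arrow Q i j)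
       (y : target Q j), exists x : source Q i, arrow_map a x = y)
    (p_ge1 : forall j : 'I_m, (1 <= p j)%E) :
  (BLCD Q p <= BL Q p)%E /\
  (BL Q p <= (\prod_(j < m) alpha Q j ^ alpha Q j)%N%:R%:E * BLCD Q p)%E.
Proof.
split.
  (* A constant valid for all families is valid for those depending only on the target, so the first
     infimum runs over a larger set. *)
  apply: ereal_inf_le_tmp => C [C0 HC]; split=> // h mh h0.
  by apply: HC => i j a.
have K0 : (0 < (\prod_(j < m) alpha Q j ^ alpha Q j)%N%:R :> R)%R.
  rewrite ltr0n; apply: prodn_gt0 => j.
  by rewrite expn_gt0; case: (alpha Q j).
(* A positive real factor moves inside the infimum, which leaves one admissible constant [C] at a
   time; an infinite [C] gives the bound [+oo]. *)
rewrite -ereal_inf_pZl//; apply: le_ereal_inf_tmp => _ [C [C0 HC] <-].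
case: C C0 HC => [C C0 HC|_ _|//]; last by rewrite gt0_muley ?leey.
apply: ereal_inf_lbound; split; first by rewrite mule_ge0// lee_fin ltW.
move=> f mf f0; exact: BL_of_BLCD.
Qed.
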